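(* Let $G=(V,E,\omega)$ be a finite connected weighted graph, let $\Omega\subsetneq V$ be a proper subset such that the induced subgraph $G[\Omega]$ is connected, let $p>1$, $q>0$, and let $u_0$ be a nonnegative function on $\Omega$ that is not identically zero. Let $u$ be a solution of $$\begin{cases}\partial_t u(x,t)=\Delta_p u^q(x,t), & x\in\Omega,\ t>0,\\ u(x,0)=u_0(x), & x\in\Omega,\\ u(x,t)=0, & x\in V\setminus\Omega,\ t\ge0.\end{cases}$$ (i) If $q(p-1)<1$, then there exists a finite time $t_0>0$ such that $u(x,t)=0$ for all $x\in V$ and all $t\ge t_0$. (ii) If $q(p-1)\ge1$, then $u(x,t)>0$ for all $x\in\Omega$ and all $t>0$.
   Context: Graph: $G=(V,E,\omega)$ is a finite connected weighted graph with no multiple edges or self-loops; $\omega:V\times V\to[0,\infty)$ is symmetric and $\omega_{xy}=\omega(x,y)>0$ if and only if $\{x,y\}\in E$ (written $x\sim y$); $\mu(x)=\sum_{y\sim x}\omega_{xy}$. Powers: for $k\in\mathbb R$, $s>0$, $k^s:=|k|^{s-1}k$ (so $0^s=0$). Operator: $\Delta_p u^q(x,t)=\frac1{\mu(x)}\sum_{y\in V}|u^q(y,t)-u^q(x,t)|^{p-2}(u^q(y,t)-u^q(x,t))\,\omega_{xy}$. Solution: a function $u:V\times[0,+\infty)\to\mathbb R$ with $u(x,\cdot)\in C^1([0,+\infty))$ for every $x\in V$ that satisfies the problem pointwise. *)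

(* Defs.v *)
From HB Require Import structures.
From mathcomp Require Import all_boot all_order all_algebra.
From mathcomp Require Import all_classical all_reals all_analysis.

Set Implicit Arguments.
Unset Strict Implicit.
Unset Printing Implicit Defensive.

Import Order.TTheory GRing.Theory Num.Theory.
Import numFieldNormedType.Exports.

Local Open Scope classical_set_scope.
Local Open Scope ring_scope.

(* The edge set is not a separate field: {x, y} is an edge iff 0 < w x y. *)
Record weighted_graph (R : realType) (V : finType) := WeightedGraph {
  weight :> V -> V -> R;
  weight_ge0 : forall x y, 0 <= weight x y;
  weight_sym : forall x y, weight x y = weight y x;
  weight_irr : forall x, weight x x = 0 }.

Definition adj (R : realType) (V : finType) (G : weighted_graph R V) : rel V :=
  fun x y => 0 < G x y.

Definition graph_connected (T : finType) (e : rel T) : Prop :=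
  forall x y : T, connect e x y.

Definition induced_rel (T : finType) (e : rel T) (A : {set T}) :
    rel {x : T | x \in A} :=
  fun x y => e (val x) (val y).

Definition vertex_measure (R : realType) (V : finType)
    (G : weighted_graph R V) (x : V) : R :=
  \sum_(y | adj G x y) G x y.

(* k^s = |k|^(s-1) k. As 0 `^ r is finite for every r, this is 0 at k = 0,
   also when s < 1. *)
Definition spow (R : realType) (k s : R) : R := `|k| `^ (s - 1) * k.

(* For 1 < p < 2 the summands with f y = f x are 0, for the same reason. *)
Definition pLaplacian (R : realType) (V : finType) (G : weighted_graph R V)
    (p : R) (f : V -> R) (x : V) : R :=
  (vertex_measure G x)^-1 *
  \sum_(y : V) `|f y - f x| `^ (p - 2) * (f y - f x) * G x y.

(* f is of class C^1 on [0, +oo): the difference quotients are restricted to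
   [0, +oo), so the derivative at 0 is one-sided and the values of f at
   negative arguments are irrelevant. *)
Definition C1_nonneg (R : realType) (f : R -> R) : Prop :=
  exists g : R -> R,
    (forall t : R, 0 <= t ->
       (f s - f t) / (s - t) @[s --> within `[0, +oo[ t^'] --> g t) /\
    {within `[0, +oo[, continuous g}.

Record is_solution (R : realType) (V : finType) (G : weighted_graph R V)
    (Omega : {set V}) (p q : R) (u0 : V -> R) (u : V -> R -> R) : Prop :=
  IsSolution {
    solution_C1 : forall x, C1_nonneg (u x);
    solution_eq : forall (x : V) (t : R), x \in Omega -> 0 < t ->
      is_derive t 1 (u x) (pLaplacian G p
        (fun y => spow (u y t) q) x);
    solution_init : forall x, x \in Omega -> u x 0 = u0 x;
    solution_bdry : forall (x : V) (t : R), x \notin Omega -> 0 <= t -> u x t = 0 }.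

(* Main.v *)
Require Import Defs.
From mathcomp Require Import all_boot all_order all_algebra.
From mathcomp Require Import all_classical all_reals all_analysis.
From mathcomp Require Import ring lra.

Import Order.TTheory GRing.Theory Num.Theory.
Import numFieldNormedType.Exports.
Local Open Scope ring_scope.

(** The proof combines two energy estimates with a pointwise argument. Write
    v = u^q and let Th be a function with nondecreasing derivative th, th 0 = 0.
    Green's formula on the graph gives, for the energy of u, that is the sum
    over Omega of mu x * Th (u x t), the identity
      d/dt energy = - 1/2 sum_(x, y) (th (u y) - th (u x)) (v y - v x)^(p-1) w_xy
    ([energy_is_derive]). Every term of the double sum is nonnegative, since v
    and th are nondecreasing functions of u.

    Taking for Th a multiple of the square of the negative part shows that u
    stays nonnegative ([solution_ge0]).

    Taking Th s = |s|^(q+1) makes the double sum the Dirichlet p-energy of v.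
    As v vanishes at some vertex outside Omega, a Poincaré inequality
    ([poincare]) bounds every value of v by this p-energy, and so the energy E
    of u satisfies E' <= - c E^a with a = p q / (q + 1). If q (p - 1) < 1, then
    a < 1 and such a function reaches 0 in finite time ([finite_extinction]).

    If q (p - 1) >= 1, a value of u can decay at most exponentially, because
    u' >= - u^(q (p-1)) >= - C u on bounded time intervals; so a vertex where
    u0 is positive stays positive ([positivity_persists]). At a positive time
    positivity passes from a vertex to its neighbours in Omega
    ([positivity_spreads]), and Omega is connected. *)

(** * Signed powers and their derivatives *)

Section SignedPower.
Set Implicit Arguments.
Unset Strict Implicit.
Local Open Scope classical_set_scope.
Variable R : realType.
Implicit Types (k l s : R).

Lemma spow0 s : spow 0 s = 0 :> R.
Proof. by rewrite /spow mulr0. Qed.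

Lemma spowN k s : spow (- k) s = - spow k s.
Proof. by rewrite /spow normrN mulrN. Qed.

Lemma spow_powR k s : 0 < s -> 0 <= k -> spow k s = k `^ s.
Proof. by move=> s0 k0; rewrite /spow ger0_norm// mulrC mulr_powRB1. Qed.

Lemma norm_spow k s : 0 < s -> `|spow k s| = `|k| `^ s.
Proof.
by move=> s0; rewrite /spow normrM ger0_norm ?powR_ge0// mulrC mulr_powRB1.
Qed.

(** For s = p - 1 this turns the pairing of a difference with its p-Laplacian
    flux into a p-th power of the difference. *)
Lemma mul_spow k s : 0 < s -> k * spow k s = `|k| `^ (s + 1).
Proof.
move=> s0; have kk : k * k = `|k| * `|k|.
  by rewrite -normrM ger0_norm// -expr2 sqr_ge0.
rewrite /spow mulrCA kk [LHS]mulrCA [_ * `|k|]mulrC mulr_powRB1//.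
by rewrite -[s in LHS](addrK 1) mulr_powRB1// addr_gt0.
Qed.

Lemma spow_gt0 k s : 0 < k -> 0 < spow k s.
Proof. by move=> k0; rewrite /spow mulr_gt0// powR_gt0// normr_gt0 gt_eqF. Qed.

Lemma spow_ge0 k s : 0 <= k -> 0 <= spow k s.
Proof. by move=> k0; rewrite /spow mulr_ge0// powR_ge0. Qed.

Lemma ler_spow s : 0 < s -> {homo (@spow R)^~ s : k l / k <= l}.
Proof.
move=> s0.
have pos k l : 0 <= k -> k <= l -> spow k s <= spow l s.
  move=> k0 kl; have l0 := le_trans k0 kl.
  by rewrite !spow_powR// ge0_ler_powR// ?nnegrE// ltW.
move=> k l kl; have [k0|k0] := leP 0 k; first exact: pos.
have [l0|l0] := leP 0 l.
  rewrite (le_trans _ (spow_ge0 _ l0))// -[k]opprK spowN oppr_le0.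
  by rewrite spow_ge0// oppr_ge0 ltW.
by rewrite -lerN2 -!spowN pos ?lerN2// oppr_ge0 ltW.
Qed.

Lemma cvg_norm_powR0 s : 0 < s -> `|k| `^ s @[k --> (0 : R)] --> (0 : R).
Proof.
move=> s0; apply/cvgrPdist_lt => e e0.
have es : 0 < e `^ s^-1 by rewrite powR_gt0.
near=> k; rewrite sub0r normrN ger0_norm ?powR_ge0//.
rewrite -[ltRHS](powRr1 (ltW e0)) -(mulVf (lt0r_neq0 s0)) powRrM.
rewrite gt0_ltr_powR ?nnegrE ?powR_ge0//.
Unshelve. all: by end_near. Qed.

(** The difference quotient at 0 of the function k * g k is g itself. This
    handles the origin, where powers of the absolute value are not covered by the
    differentiation rules for positive arguments. *)
Lemma is_derive0_mul_id (g : R -> R) :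
  g k @[k --> (0 : R)] --> g 0 -> is_derive (0 : R) 1 (fun k => k * g k) (g 0).
Proof.
move=> cg.
have key : (fun h : R => h^-1 *: (h%:A * g h%:A - 0 * g 0)) @ 0^' --> g 0.
  apply: (@cvg_trans _ (g @ 0^')); last exact: cvg_within_filter cg.
  apply: near_eq_cvg; near=> h.
  rewrite mul0r subr0 [h%:A]mulr1 /GRing.scale/= mulKf//.
  by near: h; exact: nbhs_dnbhs_neq.
have key' : (fun h : R =>
    h^-1 *: (((fun k => k * g k) \o shift 0) h%:A - 0 * g 0)) @ 0^' --> g 0.
  by under eq_fun do rewrite /= addr0.
by apply: DeriveDef; [apply/cvg_ex; exists (g 0)| apply: cvg_lim].
Unshelve. all: by end_near. Qed.

(** Away from 0 the sign is locally constant, so the absolute value may be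
    differentiated as a linear map. *)
Lemma near_normE k : k != 0 -> \forall h \near k, Num.sg k * h = `|h|.
Proof.
move=> k0; have [kn|kp|/eqP] := ltgtP k 0; last by rewrite (negPf k0).
  near=> h; rewrite ltr0_sg// mulN1r ltr0_norm//.
  by near: h; exact: lt_nbhsl.
near=> h; rewrite gtr0_sg// mul1r gtr0_norm//.
by near: h; exact: lt_nbhsr.
Unshelve. all: by end_near. Qed.

Lemma is_derive_norm_powR s k : 0 < s ->
  is_derive k 1 (fun h => `|h| `^ (s + 1)) ((s + 1) * spow k s).
Proof.
move=> s0; have [->|k0] := eqVneq k 0.
  have -> : (s + 1) * spow 0 s = spow 0 s by rewrite spow0 mulr0.
  under eq_fun do rewrite -mul_spow//.
  apply: is_derive0_mul_id; rewrite spow0; apply/cvgr0Pnorm_lt => e e0.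
  have /cvgr0Pnorm_lt/(_ e e0) := cvg_norm_powR0 s0.
  by apply: filterS => h; rewrite norm_spow// ger0_norm ?powR_ge0.
apply: (@near_eq_is_derive _ _ _ (fun h => (Num.sg k * h) `^ (s + 1))).
  by near do apply: (congr1 (fun z => z `^ _)); exact: near_normE.
have sk : 0 < Num.sg k * k by rewrite -normrEsg normr_gt0.
have dl : is_derive k 1 (fun h => Num.sg k * h) (Num.sg k).
  by apply: is_derive_eq; rewrite [_ *: _]mulr1.
have dc := is_derive1_comp (f := fun z => z `^ (s + 1))
  (is_derive1_powR (s + 1) sk) dl.
apply: (is_derive_eq dc).
rewrite -normrEsg addrK /spow {2}[k in RHS]numEsg -mulrA; congr (_ * _).
rewrite [Num.sg k * _]mulrC mulrA; congr (_ * _).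
by rewrite -{2}[s](addrK 1) [RHS]mulrC mulr_powRB1 ?addrK// ltr_wpDr.
Unshelve. all: by end_near. Qed.

Lemma is_derive_mul_norm k : is_derive k 1 (fun h => h * `|h|) (2 * `|k|).
Proof.
have [->|k0] := eqVneq k 0.
  rewrite normr0 mulr0 -[X in is_derive _ _ _ X](@normr0 _ R).
  exact/is_derive0_mul_id/norm_continuous.
apply: (@near_eq_is_derive _ _ _ (fun h : R => h * (Num.sg k * h) : R)).
  by near do apply: (congr1 (fun z => _ * z)); exact: near_normE.
apply: is_derive_eq.
rewrite /GRing.scale/= normrEsg; ring.
Unshelve. all: by end_near. Qed.

End SignedPower.

(** * Calculus on the half-line *)

Section HalfLine.
Set Implicit Arguments.
Unset Strict Implicit.
Local Open Scope classical_set_scope.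
Variable R : realType.
Implicit Types (f g df : R -> R) (s t : R).

(** Near t the increment of f is its difference quotient times the increment of
    the argument, and the quotient stays within 1 of its limit g t. The point
    t = 0, where f is only differentiable from the right, is the reason for
    working within the half-line. *)
Lemma C1_nonneg_continuous f :
  C1_nonneg f -> {within `[0, +oo[, continuous f}.
Proof.
move=> [g [dfg _]]; apply/subspace_continuousP => t /=.
rewrite in_itv/= andbT => t0; apply/cvgrPdist_lt => e e0.
have /cvgrPdist_lt/(_ 1 ltr01) := dfg t t0.
rewrite /dnbhs !near_withinE => dq.
have k0 : 0 < `|g t| + 1 by rewrite ltr_wpDl.
have ts : \forall s \near t, `|t - s| < e / (`|g t| + 1).
  by apply/nbhs_ballP; exists (e / (`|g t| + 1)) => //=; rewrite divr_gt0.
near=> s => /= s0.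
have tse : `|t - s| < e / (`|g t| + 1) by near: s.
have Hs : s != t -> `[0, +oo[%classic s ->
  `|g t - (f s - f t) / (s - t)| < 1 by near: s.
have [->|st] := eqVneq s t; first by rewrite subrr normr0.
have {}Hs := Hs st s0.
move: Hs; set Q := (f s - f t) / (s - t) => HQ.
have fQ : f t - f s = Q * (t - s).
  by rewrite -[t - s]opprB mulrN /Q divfK ?subr_eq0// opprB.
have QM : `|Q| <= `|g t| + 1.
  by rewrite -lerBlDl (le_trans _ (ltW HQ))// (distrC (g t)) lerB_dist.
rewrite fQ normrM (le_lt_trans (ler_wpM2r _ QM))//.
by rewrite mulrC -ltr_pdivlMr.
Unshelve. all: by end_near. Qed.

Lemma is_derive_continuous f t (l : R) :
  is_derive t 1 f l -> {for t, continuous f}.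
Proof.
by move=> df; apply/differentiable_continuous/derivable1_diffP; exact: ex_derive.
Qed.

Lemma is_derive_fsum (I : finType) (P : pred I) (h : I -> R -> R)
    (dh : I -> R) t :
  (forall i, P i -> is_derive t 1 (h i) (dh i)) ->
  is_derive t 1 (fun s => \sum_(i | P i) h i s) (\sum_(i | P i) dh i).
Proof.
move=> dhi.
have -> : (fun s => \sum_(i | P i) h i s) = \sum_(i | P i) h i.
  by apply/funext => s; rewrite fct_sumE.
elim/big_ind2 : _ => //; first exact: is_derive_cst.
by move=> *; exact: is_deriveD.
Qed.

Lemma within_continuous_comp (A : set R) f g : {within A, continuous f} ->
  (forall t, A t -> {for f t, continuous g}) ->
  {within A, continuous (fun t => g (f t))}.
Proof.
move=> /subspace_continuousP cf cg; apply/subspace_continuousP => t At.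
exact: (continuous_cvg _ (cg t At) (cf t At)).
Qed.

Lemma derive_le0_nincr f df : {within `[0, +oo[, continuous f} ->
  (forall t, 0 < t -> is_derive t 1 f (df t)) ->
  (forall t, 0 < t -> df t <= 0) ->
  forall s t, 0 <= s -> s <= t -> f t <= f s.
Proof.
move=> cf dfE df0; apply: ler0_derive1_nincry cf => t;
  rewrite in_itv/= andbT => t0.
  exact: (@ex_derive _ _ _ _ _ _ _ (dfE t t0)).
by rewrite derive1E (@derive_val _ _ _ _ _ _ _ (dfE t t0)) df0.
Qed.

(** As long as E is positive, the derivative of E `^ (1 - th) is at most
    - c * (1 - th), so this power lies below a line that reaches 0 in finite
    time. Since E is nonincreasing, positivity at T implies positivity on the
    whole of [0, T], which is what allows differentiating the power there. *)
Lemma finite_extinction (E dE : R -> R) (c th : R) :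
  0 < c -> th < 1 ->
  {within `[0, +oo[, continuous E} ->
  (forall t, 0 <= t -> 0 <= E t) ->
  (forall t, 0 < t -> is_derive t 1 E (dE t)) ->
  (forall t, 0 < t -> dE t <= - c * E t `^ th) ->
  exists t0, 0 < t0 /\ forall t, t0 <= t -> E t = 0.
Proof.
move=> c0 th1 cE E0 dEE dEle; have b0 : 0 < 1 - th by rewrite subr_gt0.
have ninc : forall s t, 0 <= s -> s <= t -> E t <= E s.
  apply: derive_le0_nincr cE dEE _ => t t0; apply: (le_trans (dEle t t0)).
  by rewrite mulNr oppr_le0 mulr_ge0 ?powR_ge0// ltW.
(* The zero of the line E 0 `^ (1 - th) - c * (1 - th) * t; the extra 1 keeps
   the time positive and makes the final inequality strict. *)
exists (E 0 `^ (1 - th) / (c * (1 - th)) + 1); split.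
  by rewrite ltr_wpDl// divr_ge0 ?powR_ge0// mulr_ge0// ltW.
move=> T hT; have T0 : 0 < T.
  apply: lt_le_trans hT.
  by rewrite ltr_wpDl// divr_ge0 ?powR_ge0// mulr_ge0// ltW.
apply/eqP; rewrite eq_le E0 ?(ltW T0)// andbT leNgt; apply/negP => ET.
have Epos t : 0 <= t -> t <= T -> 0 < E t.
  by move=> ? ?; rewrite (lt_le_trans ET)// ninc.
pose F t := E t `^ (1 - th) + c * (1 - th) * t.
have dF t : 0 < t -> t < T ->
    is_derive t 1 F ((1 - th) * E t `^ (1 - th - 1) * dE t + c * (1 - th)).
  move=> t0 tT; apply: is_deriveD.
    apply: (@is_derive1_comp _ (fun z => z `^ (1 - th))); last exact: dEE.
    by apply: is_derive1_powR; rewrite Epos// ltW.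
  by apply: is_derive_eq; rewrite [_ *: _]mulr1.
have FT : F T <= F 0.
  apply: (@ler0_derive1_le_cc _ F 0 T); rewrite ?in_itv/= ?lexx ?ltW//.
  - move=> t; rewrite in_itv/= => /andP[t0 tT].
    exact: (@ex_derive _ _ _ _ _ _ _ (dF t t0 tT)).
  - move=> t; rewrite in_itv/= => /andP[t0 tT].
    rewrite derive1E (@derive_val _ _ _ _ _ _ _ (dF t t0 tT)).
    have Et : 0 < E t by rewrite Epos// ltW.
    have -> : 1 - th - 1 = - th by ring.
    rewrite -mulrA [c * _]mulrC -mulrDr pmulr_rle0//.
    have pt : 0 < E t `^ (- th) by rewrite powR_gt0.
    have := ler_wpM2l (ltW pt) (dEle t t0).
    have pp : E t `^ (- th) * E t `^ th = 1.
      by rewrite powRN mulVf// gt_eqF// powR_gt0.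
    by rewrite mulrCA pp mulr1 -subr_le0 opprK.
  - have cE0T : {within `[0, T], continuous E}.
      by apply: continuous_subspaceW cE; apply: subset_itvl.
    have cp : {within `[0, T], continuous (fun t => E t `^ (1 - th))}.
      apply: (within_continuous_comp (g := fun z => z `^ (1 - th)) cE0T) => t /=.
      rewrite in_itv/= => /andP[t0 tT].
      exact/is_derive_continuous/is_derive1_powR/Epos.
    apply/subspace_continuousP => t tT; apply: cvgD.
      by move/subspace_continuousP: cp; exact.
    by apply: cvg_within_filter; apply: cvgM; [exact: cvg_cst|exact: cvg_id].
move: FT; rewrite /F mulr0 addr0 leNgt => /negP; apply.
have : E 0 `^ (1 - th) < c * (1 - th) * T.
  by rewrite mulrC -ltr_pdivrMr ?mulr_gt0// (lt_le_trans _ hT)// ltrDl.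
by move=> /lt_le_trans -> //; rewrite lerDr powR_ge0.
Qed.

End HalfLine.

(** * Green's formula and the Poincaré inequality *)

Section Graph.
Set Implicit Arguments.
Unset Strict Implicit.
Variables (R : realType) (V : finType) (G : weighted_graph R V).
Implicit Types (f g : V -> R) (p s : R) (x y z : V).

Lemma weight_nadj x y : ~~ adj G x y -> G x y = 0.
Proof.
by move=> nxy; apply/eqP; rewrite eq_le weight_ge0 andbT leNgt.
Qed.

Lemma sum_weight x : \sum_y G x y = vertex_measure G x.
Proof.
rewrite /vertex_measure [LHS](bigID (adj G x))/= [X in _ + X]big1 ?addr0//.
exact: weight_nadj.
Qed.

Lemma vertex_measure_gt0_adj x y : adj G x y -> 0 < vertex_measure G x.
Proof.
move=> xy; rewrite -sum_weight (bigD1 y)//= ltr_wpDr//.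
by apply: sumr_ge0 => z _; exact: weight_ge0.
Qed.

Lemma vertex_measure_gt0 x z :
  graph_connected (adj G) -> x != z -> 0 < vertex_measure G x.
Proof.
move=> hG xz; have /connectP[[|y r] /= + zE] := hG x z.
  by rewrite zE eqxx in xz.
by move=> /andP[xy _]; exact: vertex_measure_gt0_adj xy.
Qed.

Lemma pLaplacianE p f x : pLaplacian G p f x =
  (vertex_measure G x)^-1 * \sum_y spow (f y - f x) (p - 1) * G x y.
Proof. by rewrite /pLaplacian /spow; have -> : p - 1 - 1 = p - 2 by ring. Qed.

(** Green's formula. The flux from x to y is antisymmetric in (x, y) because the
    weight is symmetric and spow is odd, so exchanging the two summations sends
    the sum weighted by g x to minus the sum weighted by g y; averaging both
    expressions gives the factor 1/2. *)
Lemma sum_by_parts s f g :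
  \sum_x g x * (\sum_y spow (f y - f x) s * G x y) =
  - 2^-1 * \sum_x \sum_y (g y - g x) * spow (f y - f x) s * G x y.
Proof.
set S := LHS.
have SE : S = \sum_x \sum_y g x * spow (f y - f x) s * G x y.
  by apply: eq_bigr => x _; rewrite mulr_sumr; apply: eq_bigr => y _; rewrite mulrA.
have SN : S = - \sum_x \sum_y g y * spow (f y - f x) s * G x y.
  rewrite SE exchange_big/= -sumrN; apply: eq_bigr => x _.
  rewrite -sumrN; apply: eq_bigr => y _.
  by rewrite weight_sym -opprB spowN mulrN mulNr.
have -> : \sum_x \sum_y (g y - g x) * spow (f y - f x) s * G x y = - S - S.
  rewrite {1}SN opprK SE -sumrB; apply: eq_bigr => x _.
  rewrite -sumrB; apply: eq_bigr => y _; ring.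
by field.
Qed.

Lemma path_dist_le f (d : R) x (r : seq V) :
  (forall y z, adj G y z -> `|f z - f y| <= d) -> path (adj G) x r ->
  `|f x - f (last x r)| <= (size r)%:R * d.
Proof.
move=> hd; elim: r x => [|y r IH] x /=; first by rewrite subrr normr0 mul0r.
move=> /andP[/hd xy /IH yr]; rewrite -natr1 mulrDl mul1r.
rewrite (le_trans (ler_distD (f y) _ _))// addrC lerD// distrC.
by [].
Qed.

Definition dirichlet_energy p f : R := \sum_x \sum_y `|f y - f x| `^ p * G x y.

Lemma dirichlet_energy_ge0 p f : 0 <= dirichlet_energy p f.
Proof.
apply: sumr_ge0 => x _; apply: sumr_ge0 => y _.
by rewrite mulr_ge0 ?powR_ge0 ?weight_ge0.
Qed.

(** A Poincaré inequality. Each edge difference is controlled by the energy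
    through the weight of that edge; K, the sum of the inverse edge weights,
    is a bound for all of them at once. A simple path from x to the zero z of f
    has fewer than #|V| edges, and the triangle inequality along it bounds f x.
    The 1 added to the constant only makes it positive. *)
Lemma poincare p z : graph_connected (adj G) -> 0 < p ->
  exists2 C : R, 0 < C & forall f, f z = 0 ->
    forall x, `|f x| `^ p <= C * dirichlet_energy p f.
Proof.
move=> hG p0.
pose K := \sum_x \sum_(y | adj G x y) (G x y)^-1.
have K0 : 0 <= K.
  by apply: sumr_ge0 => x _; apply: sumr_ge0 => y _; rewrite invr_ge0 weight_ge0.
exists (#|V|%:R `^ p * K + 1); first by rewrite ltr_wpDl// mulr_ge0// powR_ge0.
move=> f fz x; set D := dirichlet_energy p f.
have D0 : 0 <= D := dirichlet_energy_ge0 p f.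
have KD0 : 0 <= K * D by rewrite mulr_ge0.
have edge a b : adj G a b -> `|f b - f a| <= (K * D) `^ p^-1.
  move=> ab; have w0 : 0 < G a b := ab.
  rewrite -[leLHS](@powRr1 R)// -(mulfV (lt0r_neq0 p0)) powRrM.
  rewrite ge0_ler_powR ?nnegrE ?powR_ge0 ?invr_ge0 ?(ltW p0)//.
  have wK : (G a b)^-1 <= K.
    rewrite /K (bigD1 a)//= (bigD1 b)//= -addrA lerDl addr_ge0//.
      by apply: sumr_ge0 => y _; rewrite invr_ge0 weight_ge0.
    by apply: sumr_ge0 => y _; apply: sumr_ge0 => ? _; rewrite invr_ge0 weight_ge0.
  have dD : `|f b - f a| `^ p * G a b <= D.
    rewrite /D /dirichlet_energy (bigD1 a)//= (bigD1 b)//= -addrA lerDl addr_ge0//.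
      by apply: sumr_ge0 => y _; rewrite mulr_ge0 ?powR_ge0 ?weight_ge0.
    apply: sumr_ge0 => y _; apply: sumr_ge0 => c _.
    by rewrite mulr_ge0 ?powR_ge0 ?weight_ge0.
  rewrite -ler_pdivlMr// mulrC in dD; apply: (le_trans dD).
  by rewrite ler_wpM2r.
have /connectP[r0 xr0 zE0] := hG x z.
move: zE0; case/shortenP: xr0 => r xr ur _ zE.
have := path_dist_le edge xr; rewrite -zE fz subr0 => fx.
have sr : (size r)%:R <= #|V|%:R :> R.
  rewrite ler_nat (leq_trans (leqnSn _))// -[(size r).+1]/(size (x :: r)).
  by rewrite -(card_uniqP ur) max_card.
have {}fx : `|f x| <= #|V|%:R * (K * D) `^ p^-1.
  by rewrite (le_trans fx)// ler_wpM2r// powR_ge0.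
have := ge0_ler_powR (ltW p0) _ _ fx; rewrite !nnegrE normr_ge0.
rewrite mulr_ge0 ?powR_ge0// => /(_ isT isT) /le_trans -> //.
rewrite powRM ?powR_ge0// -powRrM mulVf ?lt0r_neq0// powRr1// mulrDl mul1r mulrA.
by rewrite lerDl.
Qed.

End Graph.

(** * Energy estimates, nonnegativity and extinction *)

Section Solution.
Set Implicit Arguments.
Unset Strict Implicit.
Local Open Scope classical_set_scope.
Variables (R : realType) (V : finType) (G : weighted_graph R V).
Variables (Omega : {set V}) (p q : R) (u0 : V -> R) (u : V -> R -> R).
Hypotheses (p1 : 1 < p) (q0 : 0 < q).
Hypothesis mu_gt0 : forall x, x \in Omega -> 0 < vertex_measure G x.
Hypothesis hu : is_solution G Omega p q u0 u.

Let p10 : 0 < p - 1. Proof. by rewrite subr_gt0. Qed.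
Let p0 : 0 < p. Proof. exact: lt_trans p1. Qed.

Let v (t : R) (y : V) : R := spow (u y t) q.

Definition energy (Th : R -> R) (t : R) : R :=
  \sum_(x in Omega) vertex_measure G x * Th (u x t).

Lemma energy_continuous (Th th : R -> R) :
  (forall s : R, is_derive s 1 Th (th s)) ->
  {within `[0, +oo[, continuous (energy Th)}.
Proof.
move=> dTh; rewrite /energy.
apply/subspace_continuousP => t t0; apply: (cvg_big (op := +%R) (x0 := 0)).
  exact: add_continuous.
move=> x _.
apply: cvgM; first exact: cvg_cst.
have cu := C1_nonneg_continuous (solution_C1 hu x).
have : {within `[0, +oo[, continuous (fun t => Th (u x t))}.
  by apply: (within_continuous_comp cu) => s _; exact: is_derive_continuous (dTh _).
by move/subspace_continuousP; exact.
Qed.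

(** The energy identity. Differentiating term by term pairs th (u x t) with the
    p-Laplacian; because th vanishes at 0 and u vanishes outside Omega, the sum
    over Omega is a sum over V, to which Green's formula applies. When th is
    nondecreasing, the right-hand side is nonpositive. *)
Lemma energy_is_derive (Th th : R -> R) (t : R) :
  (forall s : R, is_derive s 1 Th (th s)) -> th 0 = 0 -> 0 < t ->
  is_derive t 1 (energy Th)
    (- 2^-1 * \sum_x \sum_y (th (u y t) - th (u x t)) *
       spow (v t y - v t x) (p - 1) * G x y).
Proof.
move=> dTh th0 t0; rewrite -sum_by_parts.
have -> : \sum_x th (u x t) * (\sum_y spow (v t y - v t x) (p - 1) * G x y) =
    \sum_(x in Omega) vertex_measure G x * (th (u x t) * pLaplacian G p (v t) x).
  rewrite [LHS](bigID (mem Omega))/= [X in _ + X]big1 ?addr0; last first.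
    by move=> x xO; rewrite (solution_bdry hu xO (ltW t0)) th0 mul0r.
  apply: eq_bigr => x xO; rewrite pLaplacianE mulrCA; congr (_ * _).
  by rewrite mulVKf// gt_eqF// mu_gt0.
apply: is_derive_fsum => x xO.
have d1 := is_derive1_comp (dTh (u x t)) (solution_eq hu xO t0).
exact: (is_deriveZ (vertex_measure G x) d1).
Qed.

(** The energy of Th s = s * s - s * |s|, which is 2 s ^ 2 for s < 0 and 0
    otherwise, measures the negative part of the solution. Its derivative th is
    nondecreasing, so the energy decreases from its initial value 0. *)
Lemma solution_ge0 : (forall x, x \in Omega -> 0 <= u0 x) ->
  forall x t, 0 <= t -> 0 <= u x t.
Proof.
move=> u00.
pose Th (s : R) := s * s - s * `|s|; pose th (s : R) := 2 * (s - `|s|).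
have dTh (s : R) : is_derive s 1 Th (th s).
  have d1 := is_deriveB (is_deriveM (is_derive_id s 1) (is_derive_id s 1))
    (is_derive_mul_norm s).
  by apply: (is_derive_eq d1); rewrite /th [_ *: _]mulr1; ring.
have th0 : th 0 = 0 by rewrite /th normr0 subr0 mulr0.
have Th0 s : 0 <= s -> Th s = 0 by move=> s0; rewrite /Th ger0_norm// subrr.
have thE s : th s = if 0 <= s then 0 else 4 * s.
  rewrite /th; case: leP => s0; first by rewrite ger0_norm// subrr mulr0.
  by rewrite ltr0_norm//; ring.
have th_mono a b : a <= b -> th a <= th b.
  by rewrite !thE => ab; have [a0|a0] := leP 0 a; have [b0|b0] := leP 0 b; lra.
have Th_ge0 s : 0 <= Th s.
  have [s0|s0] := leP 0 s; first by rewrite Th0.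
  by rewrite /Th -mulrBr ltr0_norm// opprK nmulr_rge0//; lra.
have Th_eq0 s : Th s = 0 -> 0 <= s.
  move=> /eqP; have [//|s0] := leP 0 s.
  rewrite /Th -mulrBr ltr0_norm// opprK mulf_eq0 => /orP[] /eqP sE; lra.
have dle t : 0 < t -> - 2^-1 * (\sum_x \sum_y (th (u y t) - th (u x t)) *
       spow (v t y - v t x) (p - 1) * G x y) <= 0.
  move=> t0; rewrite mulNr oppr_le0 mulr_ge0//; apply: sumr_ge0 => x _.
  apply: sumr_ge0 => y _; rewrite mulr_ge0 ?weight_ge0//.
  (* both factors have the sign of u y t - u x t *)
  have [yx|xy] := leP (u y t) (u x t).
    rewrite mulr_le0// ?subr_le0 ?th_mono// -oppr_ge0 -spowN spow_ge0//.
    by rewrite oppr_ge0 subr_le0 ler_spow.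
  rewrite mulr_ge0// ?subr_ge0 ?th_mono ?(ltW xy)// spow_ge0// subr_ge0.
  by rewrite ler_spow// ltW.
have ninc := derive_le0_nincr (energy_continuous dTh)
  (fun t => energy_is_derive dTh th0 (t := t)) dle.
have E0 : energy Th 0 = 0.
  by apply: big1 => x xO; rewrite (solution_init hu xO) Th0 ?mulr0// u00.
move=> x t t0; have [xO|xO] := boolP (x \in Omega); last first.
  by rewrite (solution_bdry hu xO t0).
have F0 y : y \in Omega -> 0 <= vertex_measure G y * Th (u y t).
  by move=> yO; rewrite mulr_ge0// ltW// mu_gt0.
have Et : energy Th t = 0.
  by apply/eqP; rewrite eq_le sumr_ge0// andbT -E0 ninc.
have /eqP := psumr_eq0P F0 Et xO.
by rewrite mulf_eq0 gt_eqF ?mu_gt0//= => /eqP; exact: Th_eq0.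
Qed.

Lemma energy_eq0 (s t : R) : 0 < s -> energy (fun z => `|z| `^ s) t = 0 ->
  forall x, x \in Omega -> u x t = 0.
Proof.
move=> s0 Et x xO.
have F0 y : y \in Omega -> 0 <= vertex_measure G y * `|u y t| `^ s.
  by move=> yO; rewrite mulr_ge0 ?powR_ge0// ltW// mu_gt0.
have /eqP := psumr_eq0P F0 Et xO.
rewrite mulf_eq0 gt_eqF ?mu_gt0//= => /eqP/powR_eq0_eq0/eqP.
by rewrite normr_eq0 => /eqP.
Qed.

(** With th = (q + 1) * u^q the dissipation in the energy identity is a multiple
    of the Dirichlet energy D of u^q. The boundary vertex z is a zero of u^q, so
    the Poincaré inequality bounds |u|^(q p) by D pointwise, hence the energy,
    a sum of |u|^(q + 1), by a multiple of D to the power 1 / a with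
    a = p q / (q + 1). The condition q (p - 1) < 1 is exactly a < 1, which is
    what finite extinction needs. *)
Lemma extinction z : z \notin Omega -> graph_connected (adj G) ->
  q * (p - 1) < 1 ->
  exists t0, 0 < t0 /\ forall x t, t0 <= t -> u x t = 0.
Proof.
move=> zO hG pq1.
have q10 : 0 < q + 1 by rewrite addr_gt0.
pose Th (s : R) := `|s| `^ (q + 1); pose th (s : R) := (q + 1) * spow s q.
have dTh (s : R) : is_derive s 1 Th (th s) := is_derive_norm_powR s q0.
have th0 : th 0 = 0 by rewrite /th spow0 mulr0.
have E0 t : 0 <= t -> 0 <= energy Th t.
  by move=> _; apply: sumr_ge0 => x xO; rewrite mulr_ge0 ?powR_ge0// ltW// mu_gt0.
have [C C0 poin] := poincare z hG p0.
pose M := \sum_(x in Omega) vertex_measure G x.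
pose a := p * q / (q + 1).
have a0 : 0 < a by rewrite divr_gt0// mulr_gt0.
have a1 : a < 1 by rewrite ltr_pdivrMr// mul1r; lra.
have M0 : 0 <= M by apply: sumr_ge0 => x /mu_gt0/ltW.
pose K := M `^ a * C + 1.
have K0 : 0 < K by rewrite ltr_wpDl// mulr_ge0 ?powR_ge0// ltW.
have Eb t : 0 < t -> energy Th t `^ a <= K * dirichlet_energy G p (v t).
  move=> t0; set D := dirichlet_energy _ _ _.
  have D0 : 0 <= D := dirichlet_energy_ge0 _ _ _.
  have CD0 : 0 <= C * D by rewrite mulr_ge0// ltW.
  have vz : v t z = 0 by rewrite /v (solution_bdry hu zO (ltW t0)) spow0.
  have EM : energy Th t <= M * (C * D) `^ a^-1.
    rewrite /energy mulr_suml; apply: ler_sum => x xO.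
    rewrite ler_wpM2l ?(ltW (mu_gt0 xO))//.
    have -> : Th (u x t) = (`|v t x| `^ p) `^ a^-1.
      rewrite /Th /v norm_spow// -!powRrM; congr (_ `^ _).
      rewrite /a; field; rewrite !lt0r_neq0//.
    by rewrite ge0_ler_powR ?nnegrE ?powR_ge0 ?invr_ge0 ?(ltW a0)// poin.
  have R0 : 0 <= M * (C * D) `^ a^-1 by rewrite mulr_ge0 ?powR_ge0.
  apply: (le_trans (ge0_ler_powR (ltW a0) (E0 t (ltW t0)) R0 EM)).
  rewrite powRM ?powR_ge0// -powRrM mulVf ?lt0r_neq0// powRr1// mulrA.
  by rewrite /K mulrDl mul1r lerDl.
have c0 : 0 < (q + 1) / 2 / K by rewrite !divr_gt0.
have dle t : 0 < t -> - 2^-1 * (\sum_x \sum_y (th (u y t) - th (u x t)) *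
       spow (v t y - v t x) (p - 1) * G x y) <=
    - ((q + 1) / 2 / K) * energy Th t `^ a.
  move=> t0.
  have -> : \sum_x \sum_y (th (u y t) - th (u x t)) *
       spow (v t y - v t x) (p - 1) * G x y = (q + 1) * dirichlet_energy G p (v t).
    rewrite /dirichlet_energy mulr_sumr; apply: eq_bigr => x _.
    rewrite mulr_sumr; apply: eq_bigr => y _.
    by rewrite /th -mulrBr [RHS]mulrA -[X in X * G x y]mulrA mul_spow// subrK.
  have DK : energy Th t `^ a / K <= dirichlet_energy G p (v t).
    by rewrite ler_pdivrMr// mulrC Eb.
  have h0 : 0 <= (q + 1) / 2 by rewrite divr_ge0// ltW.
  rewrite !mulNr lerN2 [leRHS]mulrA [2^-1 * _]mulrC [leLHS]mulrAC -[leLHS]mulrA.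
  exact: ler_wpM2l.
have [t0 [t00 ht0]] := finite_extinction c0 a1 (energy_continuous dTh) E0
  (fun t => energy_is_derive dTh th0 (t := t)) dle.
exists t0; split => // x t tt0.
have [xO|xO] := boolP (x \in Omega).
  by apply: (energy_eq0 q10) => //; exact: ht0.
by rewrite (solution_bdry hu xO)// (le_trans (ltW t00)).
Qed.

(** * Propagation of positivity *)

Hypothesis u_ge0 : forall x (t : R), 0 <= t -> 0 <= u x t.

(** The flux into x is smallest when u vanishes at all the neighbours. Each edge
    then contributes its weight times the same power of u x t, and these weights
    add up to the vertex measure, by which the p-Laplacian is divided. *)
Lemma pLaplacian_ge x (t : R) : x \in Omega -> 0 <= t ->
  - u x t `^ (q * (p - 1)) <= pLaplacian G p (v t) x.
Proof.
move=> xO t0; rewrite pLaplacianE.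
have ux := u_ge0 x t0; have mx := mu_gt0 xO.
have vE : spow (v t x) (p - 1) = u x t `^ (q * (p - 1)).
  by rewrite /v (spow_powR q0 ux) spow_powR ?powR_ge0// -powRrM.
rewrite -vE mulrC ler_pdivlMr// -sum_weight mulr_sumr; apply: ler_sum => y _.
rewrite ler_wpM2r ?weight_ge0// -spowN ler_spow//.
by rewrite -[leLHS]add0r lerD2r spow_ge0// u_ge0.
Qed.

(** On [0, t] the solution is bounded by its maximum u x m, so for an exponent
    q (p - 1) of at least 1 the loss term is at most linear, with rate C. Hence
    expR (C s) * u x s is nondecreasing in s. *)
Lemma positivity_persists x (t : R) : 1 <= q * (p - 1) -> x \in Omega ->
  0 < u x 0 -> 0 <= t -> 0 < u x t.
Proof.
move=> pq xO ux0 t0.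
have cu : {within `[0, t], continuous (u x)}.
  apply: continuous_subspaceW (C1_nonneg_continuous (solution_C1 hu x)).
  exact: subset_itvl.
have [m _ hm] := EVT_max t0 cu.
pose C := u x m `^ (q * (p - 1) - 1).
pose F s := expR (C * s) * u x s.
have dl (s : R) : is_derive s 1 (fun s : R => C * s) C.
  by apply: is_derive_eq; rewrite [_ *: _]mulr1.
have dF (s : R) : 0 < s ->
    is_derive s 1 F (expR (C * s) * (C * u x s + pLaplacian G p (v s) x)).
  move=> s0.
  have de := is_derive1_comp (is_derive_expR (C * s)) (dl s).
  apply: (is_derive_eq (is_deriveM de (solution_eq hu xO s0))).
  by rewrite /GRing.scale/= /v; ring.
have : F 0 <= F t.
  apply: (@ger0_derive1_le_cc _ F 0 t); rewrite ?in_itv/= ?lexx ?t0//.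
  - move=> s; rewrite in_itv/= => /andP[s0 _].
    exact: (@ex_derive _ _ _ _ _ _ _ (dF s s0)).
  - move=> s; rewrite in_itv/= => /andP[s0 st].
    rewrite derive1E (@derive_val _ _ _ _ _ _ _ (dF s s0)) mulr_ge0 ?expR_ge0//.
    rewrite -[C * _]opprK addrC subr_ge0.
    apply: le_trans (pLaplacian_ge xO (ltW s0)); rewrite lerN2.
    have us := u_ge0 x (ltW s0).
    rewrite -mulr_powRB1//; last exact: lt_le_trans pq.
    rewrite mulrC ler_wpM2r// ge0_ler_powR ?nnegrE ?subr_ge0//.
      by rewrite (le_trans us)// hm// in_itv/= !ltW.
    by rewrite hm// in_itv/= !ltW.
  - apply/subspace_continuousP => s st; apply: cvgM; last first.
      by move/subspace_continuousP: cu; exact.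
    apply: cvg_within_filter.
    exact: (is_derive_continuous (is_derive1_comp (is_derive_expR (C * s)) (dl s))).
rewrite /F mulr0 expR0 mul1r => /(lt_le_trans ux0).
by rewrite pmulr_rgt0 ?expR_gt0.
Qed.

(** If u y vanished at t > 0 it would have a minimum in time there, so its time
    derivative would be 0, whereas the flux from the positive neighbour x makes
    the p-Laplacian at y positive. *)
Lemma positivity_spreads x y (t : R) : adj G y x -> y \in Omega -> 0 < t ->
  0 < u x t -> 0 < u y t.
Proof.
move=> yx yO t0 ux; rewrite lt_def u_ge0 ?(ltW t0)// andbT; apply/eqP => uy.
have dy (s : R) : 0 < s -> is_derive s 1 (u y) (pLaplacian G p (v s) y).
  by move=> s0; exact: (solution_eq hu yO s0).
have : is_derive t 1 (u y) 0.
  apply: (@derive1_at_min _ _ 0 (t + 1)).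
  - by rewrite addr_ge0// ltW.
  - by move=> s; rewrite in_itv/= => /andP[/dy ds _]; exact: ex_derive.
  - by rewrite in_itv/= t0 ltrDl ltr01.
  - by move=> s; rewrite in_itv/= => /andP[/ltW s0 _]; rewrite uy u_ge0.
move=> /(@derive_val _ _ _ _ _ _ _).
rewrite (@derive_val _ _ _ _ _ _ _ (dy t t0)).
have vy : v t y = 0 by rewrite /v uy spow0.
have v0 z : 0 <= v t z by rewrite spow_ge0// u_ge0// ltW.
have vx : 0 < v t x by rewrite spow_gt0.
apply/eqP; rewrite gt_eqF// pLaplacianE mulr_gt0 ?invr_gt0 ?mu_gt0//.
rewrite (bigD1 x)//= ltr_pwDl//.
  by rewrite mulr_gt0 ?spow_gt0// vy subr0.
by apply: sumr_ge0 => z _; rewrite mulr_ge0 ?weight_ge0// spow_ge0// vy subr0.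
Qed.

Lemma positivity x0 : graph_connected (@induced_rel V (adj G) Omega) ->
  1 <= q * (p - 1) -> x0 \in Omega -> 0 < u x0 0 ->
  forall x t, x \in Omega -> 0 < t -> 0 < u x t.
Proof.
move=> hO pq x0O ux0 x t xO t0.
have step (w : {x | x \in Omega}) r : path (@induced_rel V (adj G) Omega) w r ->
    0 < u (val w) t -> 0 < u (val (last w r)) t.
  elim: r w => [//|y r IH] w /= /andP[wy yr] uw; apply: IH yr _.
  apply: positivity_spreads (valP y) t0 uw.
  by rewrite /adj weight_sym.
have /connectP[r x0r xE] := hO (exist _ x0 x0O) (exist _ x xO).
have := step _ _ x0r (positivity_persists pq x0O ux0 (ltW t0)).
by rewrite -xE.
Qed.

End Solution.

Theorem theorem5p2 (R : realType) (V : finType) (G : weighted_graph R V)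
    (hG : graph_connected (adj G))
    (Omega : {set V}) (hOmega : Omega \proper [set: V])
    (hOmegaG : graph_connected (@induced_rel V (adj G) Omega))
    (p q : R) (hp : 1 < p) (hq : 0 < q)
    (u0 : V -> R) (hu0 : forall x, x \in Omega -> 0 <= u0 x)
    (hu0_neq0 : exists2 x, x \in Omega & u0 x != 0)
    (u : V -> R -> R) (hu : is_solution G Omega p q u0 u) :
  (q * (p - 1) < 1 ->
     exists t0 : R, 0 < t0 /\ forall (x : V) (t : R), t0 <= t -> u x t = 0) /\
  (1 <= q * (p - 1) ->
     forall (x : V) (t : R), x \in Omega -> 0 < t -> 0 < u x t).
Proof.
have /properP[_ [z _ zO]] := hOmega.
have mu_gt0 x : x \in Omega -> 0 < vertex_measure G x.
  move=> xO; apply: (vertex_measure_gt0 (z := z)) => //.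
  by apply: contraNneq zO => <-.
split; first exact: (extinction hp hq mu_gt0 hu zO hG).
have [x0 x0O ux0] := hu0_neq0.
have u_ge0 := solution_ge0 hq mu_gt0 hu hu0.
move=> pq; apply: (positivity hp hq mu_gt0 hu u_ge0 hOmegaG pq x0O).
by rewrite (solution_init hu x0O) lt_def ux0 hu0.
Qed.
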